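(* Let $A:D(A)\subseteq\mathcal H\to\mathcal H$ be a self-adjoint operator on the Hilbert space $\mathcal H$, and let $\hat A$ be any singular perturbation of $A$. Then there exist a Hilbert space $\mathfrak h$, a bounded linear map $\tau\in\mathsf B(\mathcal H_+,\mathfrak h)$ with $$\overline{\mathrm{Ker}(\tau)}=\mathcal H,\qquad \mathrm{Ran}(\tau)=\mathfrak h,$$ and a (possibly unbounded) self-adjoint operator $\Theta:D(\Theta)\subseteq\mathfrak h\to\mathfrak h$ such that, with $R$, $G$, $G_*$, $G(z)$ defined from $A$ and $\tau$ as in the context, $$D(\hat A)=\{\phi\in\mathcal H:\ \phi=\phi_*+G_*\zeta_\phi,\ \phi_*\in D(A),\ \zeta_\phi\in D(\Theta),\ \Theta\,\zeta_\phi=\tau\phi_*\},$$ $$\hat A\phi=A\phi_*+RG\,\zeta_\phi .$$ Moreover, for $z\in\rho(A)$, $$z\in\rho(\hat A)\cap\rho(A)\iff 0\in\rho\big(\Theta+\tau(G_*-G(z))\big),$$ and, for $z\in\rho(\hat A)\cap\rho(A)$, $$(-\hat A+z)^{-1}=(-A+z)^{-1}+G(z)\big(\Theta+\tau(G_*-G(z))\big)^{-1}G(\bar z)^* .$$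
   Context: Hilbert spaces are complex, and $\langle\cdot,\cdot\rangle$ is the inner product of $\mathcal H$. A self-adjoint operator $\hat A$ on $\mathcal H$ is a singular perturbation of $A$ if the set $\{\phi\in D(\hat A)\cap D(A):\hat A\phi=A\phi\}$ is dense in $\mathcal H$. $\mathcal H_+$ denotes the Hilbert space given by the set $D(A)$ with inner product $\langle\phi_1,\phi_2\rangle_+:=\langle A\phi_1,A\phi_2\rangle+\langle\phi_1,\phi_2\rangle$, and $\rho(\cdot)$ denotes the resolvent set. Given $\tau\in\mathsf B(\mathcal H_+,\mathfrak h)$ as in the claim, for $z\in\rho(A)$ define $$R(z):=(-A+z)^{-1}:\mathcal H\to\mathcal H_+,\qquad G(z):=(\tau R(\bar z))^*:\mathfrak h\to\mathcal H$$ (the adjoint of the bounded operator $\tau R(\bar z):\mathcal H\to\mathfrak h$), and $$R:=R(i),\qquad G:=G(-i),\qquad G_*:=\tfrac12\,(G(i)+G(-i)).$$ In this setting $D(A)\cap\mathrm{Ran}(G_* )=\{0\}$ and $G_*$ is injective, so that $\phi_*$ and $\zeta_\phi$ in the decomposition $\phi=\phi_*+G_*\zeta_\phi$ are uniquely determined by $\phi$; moreover $\mathrm{Ran}(G_*-G(z))\subseteq D(A)$, so that $\tau(G_*-G(z))\in\mathsf B(\mathfrak h)$ is defined. The operator $\Theta+\tau(G_*-G(z))$ has domain $D(\Theta)$. *)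

(* Defs.v *)
From HB Require Import structures.
From mathcomp Require Import all_boot all_order all_algebra complex.
From mathcomp Require Import all_classical all_reals all_analysis.

Set Implicit Arguments.
Unset Strict Implicit.
Unset Printing Implicit Defensive.

Import Order.TTheory GRing.Theory Num.Theory.
Import numFieldNormedType.Exports.

Local Open Scope classical_set_scope.
Local Open Scope ring_scope.
Local Open Scope complex_scope.

(* [inner] is linear in its first argument and conjugate-linear in the second. *)
HB.mixin Record CompleteNormedModule_isHilbert (R : realType) (V : Type)
    of CompleteNormedModule R[i] V := {
  inner : {dot V for (@Num.conj R[i])} ;
  inner_normE : forall x : V, `|x| ^+ 2 = inner x x
}.

#[short(type="hilbertType")]
HB.structure Definition Hilbert (R : realType) :=
  {V of CompleteNormedModule R[i] V & CompleteNormedModule_isHilbert R V}.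

(* A partially defined map: a domain together with a total function whose
   values outside the domain are irrelevant. Every notion below depends only
   on the values on the domain, and equality of operators is [op_eq]. *)
Record operator (R : realType) (U V : hilbertType R) := Operator {
  dom : set U ;
  op_fun :> U -> V
}.

Section Operators.
Variable R : realType.
Implicit Types U V W : hilbertType R.

Definition op_eq U V (S T : operator U V) : Prop :=
  dom S = dom T /\ forall x, dom S x -> S x = T x.

Definition linear_op U V (T : operator U V) : Prop :=
  [/\ dom T 0,
      forall (a : R[i]) x y, dom T x -> dom T y -> dom T (a *: x + y) &
      forall (a : R[i]) x y, dom T x -> dom T y ->
        T (a *: x + y) = a *: T x + T y].

Definition op_add U V (S T : operator U V) : operator U V :=
  Operator (dom S `&` dom T) (fun x => S x + T x).

Definition op_scale U V (a : R[i]) (T : operator U V) : operator U V :=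
  Operator (dom T) (fun x => a *: T x).

Definition op_sub U V (S T : operator U V) : operator U V :=
  op_add S (op_scale (-1) T).

Definition op_comp U V W (S : operator V W) (T : operator U V) : operator U W :=
  Operator [set x | dom T x /\ dom S (T x)] (fun x => S (T x)).

Definition op_ran U V (T : operator U V) : set V := T @` dom T.

Definition op_ker U V (T : operator U V) : set U := [set x | dom T x /\ T x = 0].

Definition op_injective U V (T : operator U V) : Prop :=
  forall x y, dom T x -> dom T y -> T x = T y -> x = y.

(* Meaningful when [op_injective T]. *)
Definition op_inv U V (T : operator U V) : operator V U :=
  Operator (op_ran T) (fun y => xget 0 [set x | dom T x /\ T x = y]).

(* Meaningful when [dom T] is dense: then [y'] is unique for each [y]. *)
Definition adjoint U V (T : operator U V) : operator V U :=
  let adj_rel y y' := forall x, dom T x -> inner (T x) y = inner x y' in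
  Operator [set y | exists y', adj_rel y y']
           (fun y => xget 0 [set y' | adj_rel y y']).

(* membership in B(U, V) *)
Definition bounded_op U V (T : operator U V) : Prop :=
  [/\ dom T = setT, linear_op T & exists M : R[i], forall x, `|T x| <= M * `|x|].

Definition self_adjoint U (A : operator U U) : Prop :=
  [/\ linear_op A, dense (dom A) & op_eq (adjoint A) A].

(* - T + z, on the domain of T *)
Definition op_shift U (T : operator U U) (z : R[i]) : operator U U :=
  Operator (dom T) (fun x => - T x + z *: x).

Definition resolvent U (T : operator U U) (z : R[i]) : operator U U :=
  op_inv (op_shift T z).

Definition resolvent_set U (T : operator U U) : set R[i] :=
  [set z | op_injective (op_shift T z) /\ bounded_op (resolvent T z)].

Definition singular_perturbation U (A Ahat : operator U U) : Prop :=
  self_adjoint Ahat /\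
  dense [set x | [/\ dom Ahat x, dom A x & Ahat x = A x]].

Definition inner_plus U (A : operator U U) (x y : U) : R[i] :=
  inner (A x) (A y) + inner x y.

Definition norm_plus U (A : operator U U) (x : U) : R[i] :=
  sqrtC (inner_plus A x x).

(* membership in B(U_+, V), where U_+ is the domain of A with [inner_plus A] *)
Definition bounded_op_plus U V (A : operator U U) (tau : operator U V) : Prop :=
  [/\ dom tau = dom A, linear_op tau &
      exists M : R[i], forall x, dom A x -> `|tau x| <= M * norm_plus A x].

Definition Gop U V (A : operator U U) (tau : operator U V) (z : R[i]) :
    operator V U :=
  adjoint (op_comp tau (resolvent A (Num.conj z))).

Definition Gstar U V (A : operator U U) (tau : operator U V) : operator V U :=
  op_scale 2^-1 (op_add (Gop A tau 'i%C) (Gop A tau (- 'i%C))).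

Definition Theta_shift U V (A : operator U U) (tau : operator U V)
    (Theta : operator V V) (z : R[i]) : operator V V :=
  op_add Theta (op_comp tau (op_sub (Gstar A tau) (Gop A tau z))).

End Operators.

(* Main.v *)
(* A and Ahat agree on D = (-A+i)^-1 L, where L is the closed subspace on
   which the resolvents of A and Ahat at i coincide, so both extend the
   closed symmetric operator A|D. Take for h the orthogonal complement of L
   in H and, with P the orthogonal projection on h, tau := P (-A+i): its
   kernel is D, and G(-i) is the inclusion of h in H. If U is the Cayley
   transform of A, then (-Ahat+i)^-1 - (-A+i)^-1 = U Lam P for an injective
   operator Lam of h, which forces Theta = Lam^-1 - i. Unitarity of the
   Cayley transform of Ahat makes Theta symmetric with Theta + i and Theta
   - i onto, hence self-adjoint. Finally, writing phi = psi + G(z) zeta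
   with psi in D(A), one finds (-Ahat+z) phi = (-A+z) psi, and phi is in
   D(Ahat) iff (Theta + tau (G_* - G(z))) zeta = tau psi, from which the
   resolvent of Ahat can be read off. *)

From HB Require Import structures.
Require Import Defs.
From mathcomp Require Import all_boot all_order all_algebra complex.
From mathcomp Require Import all_classical all_reals all_analysis.
From mathcomp Require Import ring.

Set Implicit Arguments.
Unset Strict Implicit.
Unset Printing Implicit Defensive.

Import Order.TTheory GRing.Theory Num.Theory.
Import numFieldNormedType.Exports.

Local Open Scope classical_set_scope.
Local Open Scope ring_scope.
Local Open Scope complex_scope.

(** * Geometry of Hilbert spaces *)

Section HilbertGeometry.
Variables (R : realType) (H : hilbertType R).
Local Notation C := R[i].
Implicit Types (x y u v : H) (a : C).

Lemma innerDl x y u : inner (x + y) u = inner x u + inner y u.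
Proof. exact: linearDl. Qed.

Lemma innerDr x y u : inner u (x + y) = inner u x + inner u y.
Proof. exact: linearDr. Qed.

Lemma innerNl x u : inner (- x) u = - inner x u.
Proof. exact: linearNl. Qed.

Lemma innerNr x u : inner u (- x) = - inner u x.
Proof. exact: linearNr. Qed.

Lemma innerBl x y u : inner (x - y) u = inner x u - inner y u.
Proof. exact: linearBl. Qed.

Lemma innerBr x y u : inner u (x - y) = inner u x - inner u y.
Proof. exact: linearBr. Qed.

Lemma innerZl a x u : inner (a *: x) u = a * inner x u.
Proof. exact: linearZl_LR. Qed.

Lemma innerZr a x u : inner u (a *: x) = Num.conj a * inner u x.
Proof. exact: linearZr_LR. Qed.

Lemma inner0l x : inner 0 x = 0.
Proof. exact: linear0l. Qed.

Lemma inner0r x : inner x 0 = 0.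
Proof. exact: linear0r. Qed.

Lemma innerC x y : inner x y = Num.conj (inner y x).
Proof. by rewrite (hermC inner) mul1r. Qed.

Lemma inner_ge0 x : 0 <= inner x x.
Proof. by rewrite -inner_normE exprn_ge0. Qed.

Lemma inner_eq0 x : (inner x x == 0) = (x == 0).
Proof. by rewrite -inner_normE expf_eq0 /= normr_eq0. Qed.

Lemma inner_orth0 x : (forall y, inner x y = 0) -> x = 0.
Proof. by move=> /(_ x)/eqP; rewrite inner_eq0 => /eqP. Qed.

Lemma inner_ext x y : (forall u, inner u x = inner u y) -> x = y.
Proof.
move=> e; apply/subr0_eq/inner_orth0 => u.
by rewrite innerC innerBr e subrr rmorph0.
Qed.

Lemma inner_extl x y : (forall u, inner x u = inner y u) -> x = y.
Proof. by move=> e; apply: inner_ext => u; rewrite innerC e -innerC. Qed.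

Lemma inner_sub_proj x v : v != 0 ->
  let t := inner x v / inner v v in
  inner (x - t *: v) (x - t *: v) =
  inner x x - `|inner x v| ^+ 2 / inner v v.
Proof.
move=> v0 t; have vv0 : inner v v != 0 by rewrite inner_eq0.
have tvx : inner (x - t *: v) v = 0.
  by rewrite innerBl innerZl /t divfK // subrr.
rewrite innerBr innerZr tvx mulr0 subr0 innerBl innerZl; congr (_ - _).
by rewrite /t (innerC v x) normCK mulrAC.
Qed.

Lemma CauchySchwarz_inner x v : `|inner x v| <= `|x| * `|v|.
Proof.
have [->|v0] := eqVneq v 0; first by rewrite inner0r !normr0 mulr0.
rewrite -(@ler_pXn2r _ 2) ?nnegrE ?mulr_ge0 // exprMn !inner_normE.
have vv0 : 0 < inner v v by rewrite lt_def inner_eq0 v0 inner_ge0.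
have := inner_ge0 (x - (inner x v / inner v v) *: v).
by rewrite inner_sub_proj // subr_ge0 ler_pdivrMr.
Qed.

Lemma parallelogram x y :
  inner (x + y) (x + y) + inner (x - y) (x - y) =
  2 * inner x x + 2 * inner y y.
Proof.
rewrite !(innerDl, innerDr, innerBl, innerBr, innerNl, innerNr).
ring.
Qed.

Lemma normDZ_le (V : normedModType C) (x y : V) a (M : C) :
  `|y| <= M * `|x| -> `|x + a *: y| <= (1 + `|a| * M) * `|x|.
Proof.
move=> yM; rewrite (le_trans (ler_normD _ _)) // normrZ mulrDl mul1r lerD2l.
by rewrite -mulrA ler_wpM2l.
Qed.

(* Cantor's intersection theorem, without closedness of the sets. *)
Lemma nested_cluster (S : C -> set H) :
    (forall e, 0 < e -> S e !=set0) ->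
    (forall e e', 0 < e -> e <= e' -> S e `<=` S e') ->
    (forall d, 0 < d -> exists2 e, 0 < e &
       forall x y, S e x -> S e y -> `|x - y| < d) ->
  exists l, forall e d, 0 < e -> 0 < d -> exists2 x, S e x & `|l - x| < d.
Proof.
move=> S0 Sle Scau.
pose F := filter_from [set e : C | 0 < e] S.
have FF : ProperFilter F.
  apply: filter_from_proper; last by move=> e /S0.
  apply: filter_from_filter; first by exists 1; exact: ltr01.
  move=> e e' /= e0 e'0.
  have /orP[ee'|e'e] := real_leVge (gtr0_real e0) (gtr0_real e'0).
    by exists e => // x Sx; split => //; exact: Sle Sx.
  by exists e' => // x Sx; split => //; exact: Sle Sx.
have Fc : cauchy F.
  apply/cauchyP => _/posnumP[d]; have [e e0 Se] := Scau _ (gt0 d).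
  have [x Sx] := S0 _ e0; exists x; exists e => // y Sy.
  by rewrite -ball_normE /=; exact: Se.
have [l Fl] : exists l : H, F --> l.
  by exists (lim F) => B FB; exact: (@cauchy_cvg H F FF Fc).
exists l => e d e0 d0.
have [e' e'0 Se'] : F (ball l d) by apply: Fl; exact: nbhsx_ballx.
have FS : F (S e `&` S e') by apply: filterI; [exists e | exists e'].
have [x [Sx Sx']] := filter_ex FS.
by exists x => //; have := Se' _ Sx'; rewrite -ball_normE.
Qed.

End HilbertGeometry.

(* Proves vector identities by pairing both sides with an arbitrary vector. *)
Ltac hilbert_ring :=
  apply: inner_extl => ?; rewrite ?(innerDl, innerNl, innerZl, inner0l); ring.

(** * Orthogonal projection onto a linear subspace, and density *)

Section Projection.
Variables (R : realType) (H : hilbertType R).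
Local Notation C := R[i].
Implicit Types (x y u v : H) (a : C) (M : set H).

Definition linear_subspace M : Prop :=
  M 0 /\ forall a x y, M x -> M y -> M (a *: x + y).

Definition orth M : set H := [set x | forall y, M y -> inner x y = 0].

(** The order on [R[i]] is only partial, so the infimum of the squared distances is taken in [R],
    over their real parts, and then embedded. *)
Lemma exists_dist2 M x : M !=set0 ->
  exists2 d : C, forall y, M y -> d <= inner (x - y) (x - y) &
    forall e, 0 < e -> exists2 y, M y & inner (x - y) (x - y) < d + e.
Proof.
move=> [m Mm].
pose f y := complex.Re (inner (x - y) (x - y)).
have fE y : (f y)%:C = inner (x - y) (x - y).
  by apply: RRe_real; exact/ger0_real/inner_ge0.
have f0 y : 0 <= f y by rewrite -ler0c fE inner_ge0.
have infE : has_inf (f @` M).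
  by split; [exists (f m); exists m | exists 0 => _ [y _ <-]].
exists (inf (f @` M))%:C.
  by move=> y My; rewrite -fE lecR; apply: ge_inf; [case: infE | exists y].
move=> e e0.
have eE : e = (complex.Re e)%:C by rewrite RRe_real // gtr0_real.
have e'0 : 0 < complex.Re e by rewrite -ltcR -eE.
have [_ [y My <-] ye] := inf_adherent e'0 infE.
by exists y => //; rewrite -fE eE -rmorphD /= ltcR.
Qed.

(** Limit passages below are reduced to this estimate; a nonzero [c] is refuted with [e] equal to
    [|c| / (k + 1)]. *)
Lemma approx_eq0 (c k : C) :
  0 <= k -> (forall e, 0 < e -> `|c| <= e * k) -> c = 0.
Proof.
move=> k0 xv; apply/eqP; rewrite -normr_eq0; apply/negPn/negP => n0.
have p0 : 0 < `|c| by rewrite lt_def n0 normr_ge0.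
have k1 : 0 < k + 1 by rewrite ltr_wpDl.
have := xv _ (divr_gt0 p0 k1).
by rewrite mulrAC ler_pdivlMr // ler_pM2l // gerDl ler10.
Qed.

(** [M] may fail to be closed, so [p] is only approximated from [M]. By the parallelogram law,
    almost minimizing points are close to each other, and [nested_cluster] yields [p]. *)
Lemma exists_projection M x : linear_subspace M ->
  exists2 p, forall e, 0 < e -> exists2 y, M y & `|p - y| < e & orth M (x - p).
Proof.
move=> [M0 Mlin].
have MD y y' : M y -> M y' -> M (y + y').
  by move=> My My'; rewrite -[y]scale1r; exact: Mlin.
have MZ a y : M y -> M (a *: y) by move=> My; rewrite -[_ *: _]addr0;
  exact: Mlin.
have [d dM dinf] : exists2 d : C, forall y, M y -> d <= inner (x - y) (x - y) &
    forall e, 0 < e -> exists2 y, M y & inner (x - y) (x - y) < d + e.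
  by apply: exists_dist2; exists 0.
pose S e := [set y | M y /\ inner (x - y) (x - y) < d + e].
have [||e e0|p pS] := @nested_cluster _ _ S.
- by move=> e /dinf[y My ye]; exists y.
- by move=> e e' e0 ee' y [My ye]; split=> //;
    rewrite (lt_le_trans ye) // lerD2l.
(* Two points of [M] with squared distance to [x] below [d + e'] satisfy
   [|y - y'|^2 < 4 (d + e') - 4 d = 4 e'], because their midpoint lies in [M]. *)
- exists (e ^+ 2 / 4); first by rewrite divr_gt0 ?exprn_gt0 // ltr0n.
  move=> y y' [My ye] [My' ye'].
  rewrite -(@ltr_pXn2r _ 2) ?nnegrE ?(ltW e0) // inner_normE.
  have := parallelogram (x - y) (x - y').
  have -> : x - y - (x - y') = y' - y by rewrite opprB addrC addrA subrK.
  have -> : x - y + (x - y') = 2 *: (x - 2^-1 *: (y + y')).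
    rewrite scalerBr scalerA mulfV ?pnatr_eq0 // scale1r scaler_nat mulr2n.
    by rewrite addrACA opprD.
  rewrite innerZl innerZr conjC_nat.
  have := dM _ (MZ 2^-1 _ (MD _ _ My My')).
  rewrite -[inner (y' - y) _]inner_normE distrC inner_normE.
  move: (inner (x - _ *: _) _) (inner (y - y') _) (inner (x - y) _)
    (inner (x - y') _) ye ye' => s t u v ue ve ds E.
  have -> : t = 2 * u + 2 * v - 4 * s by rewrite -E; ring.
  have -> : e ^+ 2 = 2 * (d + e ^+ 2 / 4) + 2 * (d + e ^+ 2 / 4) - 4 * d.
    by field.
  apply: ltr_leD; last by rewrite lerN2 ler_pM2l // ltr0n.
  by apply: ltrD; rewrite ltr_pM2l ?ltr0n.
exists p; first by move=> e e0; have [y [My _] ye] := pS 1 e ltr01 e0; exists y.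
move=> v Mv; have [->|v0] := eqVneq v 0; first by rewrite inner0r.
have vn0 : 0 < `|v| by rewrite normr_gt0.
apply: (@approx_eq0 _ (`|v| + `|v|)); first by rewrite addr_ge0.
(* Take [y] within [e] of [p] and minimal up to [e ^+ 2]. Comparing it with [y] moved along [v] to
   the closest point to [x] gives [|inner (x - y) v| <= e * |v|]; replacing [y] by [p] costs another
   [e * |v|]. *)
move=> e e0; have e20 : 0 < e ^+ 2 by rewrite exprn_gt0.
have [y [My ye] yp] := pS _ _ e20 e0.
have -> : x - p = (x - y) - (p - y) by rewrite opprB addrA subrK.
rewrite innerBl mulrDr (le_trans (ler_normB _ _)) // lerD //; last first.
  by rewrite (le_trans (CauchySchwarz_inner _ _)) // ler_pM2r // ltW.
rewrite -(@ler_pXn2r _ 2) ?nnegrE ?mulr_ge0 ?(ltW e0) // exprMn inner_normE.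
have vv0 : 0 < inner v v by rewrite -inner_normE exprn_gt0.
have := dM _ (Mlin (inner (x - y) v / inner v v) _ _ Mv My).
rewrite opprD addrCA addrC inner_sub_proj //.
rewrite lerBrDr -lerBrDl -ler_pdivrMr // => dy.
rewrite (le_trans dy) // lerBlDl; exact: ltW.
Qed.

Lemma denseP M :
  dense M <-> forall x e, 0 < e -> exists2 y, M y & `|x - y| < e.
Proof.
split=> [dM x e e0|aM U [x Ux] Uo].
  have [y [xy My]] : ball x e `&` M !=set0.
    apply: dM; first by exists x; exact: ballxx.
    exact: ball_open.
  by exists y => //; move: xy; rewrite -ball_normE.
have /nbhs_ballP[e e0 xeU] : nbhs x U by exact: open_nbhs_nbhs.
have [y My xy] := aM x e e0.
by exists y; split=> //; apply: xeU; rewrite -ball_normE.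
Qed.

Lemma dense_orth0 M : linear_subspace M -> (forall x, orth M x -> x = 0) ->
  dense M.
Proof.
move=> sM M0; apply/denseP => x.
have [p pM /M0/subr0_eq ->] := exists_projection x sM; exact: pM.
Qed.

Lemma orth_dense0 M x : dense M -> orth M x -> x = 0.
Proof.
move=> /denseP dM xM; apply/eqP; rewrite -inner_eq0; apply/eqP.
apply: (@approx_eq0 _ `|x|) => // e e0.
have [y My xy] := dM x e e0.
rewrite -[X in inner _ X](subrK y) innerDr (xM y) // addr0.
by rewrite (le_trans (CauchySchwarz_inner _ _)) // mulrC ler_wpM2r // ltW.
Qed.

End Projection.

(** * The orthogonal complement as a Hilbert space *)

Section OrthComplement.
Variables (R : realType) (H : hilbertType R) (L : set H).
Local Notation C := R[i].

(** Boolean form of [orth L], as required to build a subtype with its inherited algebraic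
    structures. *)
Definition orth_pred : pred H := fun x => `[< orth L x >].

Lemma orth_predP x : reflect (orth L x) (orth_pred x).
Proof. exact: asboolP. Qed.

Lemma orth_submod_closed : submod_closed orth_pred.
Proof.
split=> [|a x y /orth_predP xL /orth_predP yL]; apply/orth_predP => l Ll.
  by rewrite inner0l.
by rewrite innerDl innerZl xL // yL // mulr0 addr0.
Qed.

HB.instance Definition _ :=
  GRing.isSubmodClosed.Build C H orth_pred
    (GRing.submod_closed_semi orth_submod_closed).

Definition orthc : Type := {x : H | orth_pred x}.

HB.instance Definition _ := [isSub of orthc for @sval H orth_pred].
HB.instance Definition _ := [Choice of orthc by <:].
HB.instance Definition _ := [SubChoice_isSubLmodule of orthc by <:].

Let cnorm (x : orthc) : C := `|val x|.

Let cnormD x y : cnorm (x + y) <= cnorm x + cnorm y.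
Proof. by rewrite /cnorm raddfD /= ler_normD. Qed.

Let cnormZ (a : C) x : cnorm (a *: x) = `|a| * cnorm x.
Proof. by rewrite /cnorm linearZ /= normrZ. Qed.

Let cnorm0 x : cnorm x = 0 -> x = 0.
Proof. by move=> /normr0_eq0 x0; apply: val_inj; rewrite x0 raddf0. Qed.

HB.instance Definition _ := Lmodule_isNormed.Build C orthc cnormD cnormZ cnorm0.

Lemma orthc_normE (x : orthc) : `|x| = `|val x|.
Proof. by []. Qed.

(** The image filter converges in [H], and orthogonality to [L] passes to the limit by
    Cauchy-Schwarz. *)
Let orthc_complete (F : set_system orthc) : ProperFilter F -> cauchy F -> cvg F.
Proof.
move=> FF /cauchyP Fc.
pose G : set_system H := (val : orthc -> H) @ F.
have GF : ProperFilter G by exact: fmap_proper_filter.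
have Gc : cauchy G.
  apply/cauchyP => e e0; have [x xF] := Fc e e0; exists (val x).
  move: xF; rewrite /G /= -!ball_normE; apply: filterS => y /=.
  by rewrite orthc_normE raddfB.
have [l Gl] : exists l : H, G --> l.
  by exists (lim G) => B FB; exact: (@cauchy_cvg H G GF Gc).
have near_l e : 0 < e -> F [set y : orthc | `|l - val y| < e].
  move=> e0; have := Gl _ (nbhsx_ballx l e e0).
  by rewrite /G /= -ball_normE.
have lL : orth_pred l.
  apply/orth_predP => v Lv; apply: (@approx_eq0 _ _ `|v|) => // e e0.
  have [y /= ye] := filter_ex (near_l e e0).
  have /orth_predP/(_ v Lv) yv := valP y.
  rewrite -[l](subrK (val y)) innerDl yv addr0.
  by rewrite (le_trans (CauchySchwarz_inner _ _)) // ler_wpM2r // ltW.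
apply/cvg_ex; exists (exist _ l lL : orthc) => B /nbhs_ballP[e e0 eB].
apply: filterS (near_l e e0) => y /= ye; apply: eB.
by rewrite -ball_normE /= orthc_normE raddfB.
Qed.

HB.instance Definition _ := Uniform_isComplete.Build orthc orthc_complete.

Let cinner (x y : orthc) : C := inner (val x) (val y).

Let cinner_bilinear : bilinear_for ( *%R) (Num.conj \; *%R) cinner.
Proof.
split=> u a x y.
  by rewrite /cinner linearP /= innerDl innerZl.
by rewrite /cinner !linearP.
Qed.

HB.instance Definition _ := bilinear_isBilinear.Build C orthc orthc C
  ( *%R) (Num.conj \; *%R) cinner cinner_bilinear.

Let cinnerC (x y : orthc) : cinner x y = (-1) ^+ false * Num.conj (cinner y x).
Proof. by rewrite mul1r /cinner innerC. Qed.

HB.instance Definition _ := isHermitianSesquilinear.Build C orthc false Num.conj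
  cinner cinnerC.

Let cinner_gt0 (x : orthc) : x != 0 -> 0 < cinner x x.
Proof.
move=> x0; rewrite /cinner -inner_normE exprn_gt0 // normr_gt0.
by apply: contraNneq x0 => x0; apply/eqP/val_inj; rewrite x0 raddf0.
Qed.

HB.instance Definition _ := isDotProduct.Build C orthc cinner cinner_gt0.

Let cinner_normE (x : orthc) : `|x| ^+ 2 = cinner x x.
Proof. exact: inner_normE. Qed.

HB.instance Definition _ := CompleteNormedModule_isHilbert.Build R orthc
  cinner_normE.

Lemma orthc_innerE (x y : orthc) : inner x y = inner (val x) (val y).
Proof. by []. Qed.

End OrthComplement.

(** * Projection onto the orthogonal complement of a closed subspace *)

Section OrthProjection.
Variables (R : realType) (H : hilbertType R) (L : set H).
Local Notation C := R[i].

Definition orth_proj (f : H) : orthc L := xget 0 [set q | L (f - val q)].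

Hypotheses (sL : linear_subspace L) (cL : closed L).

Lemma orth_projP f : L (f - val (orth_proj f)).
Proof.
have [p pL /orth_predP fpL] := exists_projection f sL.
apply: (@xgetPex _ 0 [set q : orthc L | L (f - val q)]).
exists (exist _ (f - p) fpL : orthc L) => /=.
rewrite subKr; apply: cL => B /nbhs_ballP[e e0 eB].
have [y Ly py] := pL e e0; exists y; split=> //; apply: eB.
by rewrite -ball_normE.
Qed.

Lemma orthc_inner0 (x : H) (y : orthc L) : L x -> inner x (val y) = 0.
Proof.
by have /orth_predP yL := valP y; move=> /yL xy; rewrite innerC xy rmorph0.
Qed.

(** The projection is the adjoint of the inclusion [val]. Linearity and the norm bound are deduced
    from this by testing against vectors of the complement. *)
Lemma orth_proj_inner (x : H) (y : orthc L) : inner (orth_proj x) y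
  = inner x (val y).
Proof.
apply/esym/eqP; rewrite orthc_innerE -subr_eq0 -innerBl.
by rewrite orthc_inner0 //; exact: orth_projP.
Qed.

Lemma orth_projK (y : orthc L) : orth_proj (val y) = y.
Proof.
apply: inner_ext => u; rewrite [LHS]innerC orth_proj_inner -innerC //.
Qed.

Lemma orth_proj_linear a x y :
  orth_proj (a *: x + y) = a *: orth_proj x + orth_proj y.
Proof.
apply: inner_ext => u; rewrite innerC [RHS]innerC; congr (Num.conj _).
by rewrite innerDl innerZl !orth_proj_inner innerDl innerZl.
Qed.

Lemma orth_projB x y : orth_proj (x - y) = orth_proj x - orth_proj y.
Proof. by rewrite addrC -scaleN1r orth_proj_linear scaleN1r addrC. Qed.

Lemma orth_proj0 x : L x -> orth_proj x = 0.
Proof.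
by move=> Lx; apply: inner_orth0 => u; rewrite orth_proj_inner orthc_inner0.
Qed.

Lemma orth_proj_norm x : `|orth_proj x| <= `|x|.
Proof.
have [->|p0] := eqVneq (orth_proj x) 0; first by rewrite normr0.
rewrite -(@ler_pM2r _ `|orth_proj x|) ?normr_gt0 // -expr2 inner_normE.
rewrite orth_proj_inner -[X in X <= _]ger0_norm; last first.
  by rewrite -orth_proj_inner inner_ge0.
exact: CauchySchwarz_inner.
Qed.

End OrthProjection.

(** * Self-adjoint operators and their resolvents *)

Section LinearOperators.
Variables (R : realType) (U V : hilbertType R) (T : operator U V).
Local Notation C := R[i].
Implicit Types (x y : U) (a z : C).

Lemma op_invK x : op_injective T -> dom T x -> op_inv T (T x) = x.
Proof.
move=> iT Tx; have [] : [set u | dom T u /\ T u = T x] (op_inv T (T x)).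
  by apply: xgetPex; exists x.
by move=> Tu; exact: iT.
Qed.

Lemma op_invP (y : V) : dom (op_inv T) y -> dom T (op_inv T y) /\ T (op_inv T y)
  = y.
Proof.
by case=> x Tx xy; apply: (@xgetPex _ _ [set u | dom T u /\ T u = y]); exists x.
Qed.

Lemma adjointP u v : dom (adjoint T) v -> dom T u ->
  inner (T u) v = inner u (adjoint T v).
Proof.
move=> Tv; move: u; apply: (@xgetPex _ 0 [set v' | forall u, dom T u ->
  inner (T u) v = inner u v']).
exact: Tv.
Qed.

(** Density makes the value of the adjoint unique, so the choice made in [adjoint] becomes
    computable from any vector satisfying the relation. *)
Lemma adjoint_eq v v' : dense (dom T) ->
  (forall u, dom T u -> inner (T u) v = inner u v') ->
  dom (adjoint T) v /\ adjoint T v = v'.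
Proof.
move=> dT vv'; have Tv : dom (adjoint T) v by exists v'.
split=> //; apply/subr0_eq/(orth_dense0 dT) => u Tu.
by rewrite innerC innerBr -adjointP // vv' // subrr rmorph0.
Qed.

Hypothesis lT : linear_op T.

Lemma lin_dom0 : dom T 0. Proof. by case: lT. Qed.

Lemma lin_domP a x y : dom T x -> dom T y -> dom T (a *: x + y).
Proof. by case: lT => _ + _ => /[apply] /[apply]. Qed.

Lemma lin_P a x y : dom T x -> dom T y -> T (a *: x + y) = a *: T x + T y.
Proof. by case: lT => _ _ => /[apply] /[apply]. Qed.

Lemma lin_0 : T 0 = 0.
Proof.
have := lin_P 1 lin_dom0 lin_dom0; rewrite !scale1r !addr0 => /eqP.
by rewrite -subr_eq0 opprD addNKr oppr_eq0 => /eqP.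
Qed.

Lemma lin_domZ a x : dom T x -> dom T (a *: x).
Proof.
by move=> Tx; rewrite -[_ *: _]addr0; apply: lin_domP => //; exact: lin_dom0.
Qed.

Lemma lin_Z a x : dom T x -> T (a *: x) = a *: T x.
Proof.
by move=> Tx; rewrite -[in LHS](addr0 (a *: x)) lin_P ?lin_0 ?addr0 //;
  exact: lin_dom0.
Qed.

Lemma lin_domD x y : dom T x -> dom T y -> dom T (x + y).
Proof. by move=> Tx Ty; rewrite -[x]scale1r; exact: lin_domP. Qed.

Lemma lin_D x y : dom T x -> dom T y -> T (x + y) = T x + T y.
Proof. by move=> Tx Ty; rewrite -[in LHS](scale1r x) lin_P // scale1r. Qed.

Lemma lin_domB x y : dom T x -> dom T y -> dom T (x - y).
Proof.
by move=> Tx Ty; apply: lin_domD => //; rewrite -[- y]scaleN1r; exact: lin_domZ.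
Qed.

Lemma lin_B x y : dom T x -> dom T y -> T (x - y) = T x - T y.
Proof.
move=> Tx Ty; have TNy := lin_domZ (-1) Ty.
by rewrite -[- y]scaleN1r lin_D // lin_Z // scaleN1r.
Qed.

(** The constant in [bounded_op] is an arbitrary complex number; its modulus serves as well, since
    [M * |x|] dominates a norm and is thus nonnegative. *)
Lemma bounded_op_norm : bounded_op T -> exists2 M : C, 0 <= M & forall x, `|T x|
  <= M * `|x|.
Proof.
case=> _ _ [M TM]; exists `|M| => // x; rewrite -[X in _ * X]normr_id -normrM.
by rewrite ger0_norm //; exact: le_trans (TM x).
Qed.

End LinearOperators.

(** * Algebra of resolvents *)

Section Resolvent.
Variables (R : realType) (H : hilbertType R) (T : operator H H).
Local Notation C := R[i].
Implicit Types (x y : H) (a z : C).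

Hypothesis lT : linear_op T.

Lemma op_shift_linear z : linear_op (op_shift T z).
Proof.
split=> [|a x y /= Tx Ty|a x y /= Tx Ty]; first exact: lin_dom0 lT.
  exact: (lin_domP lT).
rewrite (lin_P lT) // opprD scalerDr scalerDr addrACA scalerN;
  congr (- _ + _ + _).
by rewrite !scalerA mulrC.
Qed.

Lemma resolventP z f : resolvent_set T z ->
  dom T (resolvent T z f) /\ - T (resolvent T z f) + z *: resolvent T z f = f.
Proof.
by case=> _ [dT _ _]; apply: (@op_invP _ _ _ (op_shift T z)); rewrite dT.
Qed.

Lemma resolventK z x : resolvent_set T z -> dom T x ->
  resolvent T z (- T x + z *: x) = x.
Proof. by case=> iT _ Tx; exact: (op_invK iT). Qed.

Lemma resolvent_linear z a f g : resolvent_set T z ->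
  resolvent T z (a *: f + g) = a *: resolvent T z f + resolvent T z g.
Proof. by case=> _ [[dT [_ _ rl] _]]; apply: rl; rewrite dT. Qed.

Lemma resolvent0 z : resolvent_set T z -> resolvent T z 0 = 0.
Proof. by case=> _ [_ /lin_0]. Qed.

Lemma resolventZ z a f : resolvent_set T z ->
  resolvent T z (a *: f) = a *: resolvent T z f.
Proof.
by move=> rz; rewrite -[a *: f]addr0 resolvent_linear // resolvent0 // addr0.
Qed.

Lemma resolventD z f g : resolvent_set T z ->
  resolvent T z (f + g) = resolvent T z f + resolvent T z g.
Proof. by move=> rz; rewrite -[f]scale1r resolvent_linear // !scale1r. Qed.

Lemma resolventB z f g : resolvent_set T z ->
  resolvent T z (f - g) = resolvent T z f - resolvent T z g.
Proof.
by move=> rz; rewrite resolventD // -scaleN1r resolventZ // scaleN1r.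
Qed.

Lemma resolvent_setI z :
    (forall x, dom T x -> - T x + z *: x = 0 -> x = 0) ->
    (exists M : C, forall f,
       exists x, [/\ dom T x, - T x + z *: x = f & `|x| <= M * `|f|]) ->
  resolvent_set T z.
Proof.
move=> i0 [M sM].
have lz := op_shift_linear z.
have iT : op_injective (op_shift T z).
  move=> x y Tx Ty xy; apply/subr0_eq/i0; first exact: (lin_domB lT).
  by have := lin_B lz Tx Ty; rewrite xy subrr.
have dT : dom (resolvent T z) = setT.
  apply/seteqP; split=> // f _; have [x [Tx xf _]] := sM f.
  by exists x.
have rP f : dom T (resolvent T z f) /\ op_shift T z (resolvent T z f) = f.
  by apply: (@op_invP _ _ _ (op_shift T z)); rewrite -/(resolvent T z) dT.
split=> //; split=> //.
  split; rewrite ?dT // => a x y _ _.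
  have [xT xE] := rP x; have [yT yE] := rP y.
  rewrite -[in LHS]xE -[in LHS]yE -(lin_P lz) //.
  by rewrite /resolvent op_invK //; exact: (lin_domP lz).
exists M => f; have [x [Tx xf xM]] := sM f.
by rewrite -[in X in X <= _]xf (@op_invK _ _ _ (op_shift T z)).
Qed.

End Resolvent.

(** * Criteria for self-adjointness and for membership in the resolvent set *)

Section SelfAdjoint.
Variables (R : realType) (H : hilbertType R).
Local Notation C := R[i].
Implicit Types (A : operator H H) (x y : H) (z : C).

Lemma sa_sym A x y : self_adjoint A -> dom A x -> dom A y ->
  inner (A x) y = inner x (A y).
Proof.
case=> _ _ [dA A'A] Ax Ay; rewrite -dA in Ay.
by rewrite -(A'A _ Ay) -adjointP.
Qed.

Lemma sa_max A y y' : self_adjoint A ->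
  (forall x, dom A x -> inner (A x) y = inner x y') -> dom A y /\ A y = y'.
Proof.
case=> _ dnA [dA A'A] yy'; have [dy Ey] := adjoint_eq dnA yy'.
by split; rewrite -?dA // -A'A.
Qed.

(** The basic criterion. If [x] is orthogonal to the domain, a solution [y] of [A y + conj z y = x]
    is orthogonal to the range of [A + z], hence zero. If [y] is in the domain of the adjoint, the
    [u] in [dom A] with [(A + conj z) u = (adjoint A + conj z) y] equals [y] for the same reason. *)
Lemma self_adjointI A z : linear_op A ->
    (forall x y, dom A x -> dom A y -> inner (A x) y = inner x (A y)) ->
    (forall f, exists2 x, dom A x & A x + z *: x = f) ->
    (forall f, exists2 x, dom A x & A x + Num.conj z *: x = f) ->
  self_adjoint A.
Proof.
move=> lA symA surz surz'.
have shift x y : dom A x -> dom A y ->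
    inner (A x + z *: x) y = inner x (A y + Num.conj z *: y).
  move=> Ax Ay; rewrite innerDl innerDr innerZl innerZr symA //.
  by rewrite conjCK.
have dA : dense (dom A).
  apply: dense_orth0; first by case: lA.
  move=> x xA; have [y Ay yx] := surz' x.
  suff y0 : y = 0 by rewrite -yx y0 (lin_0 lA) scaler0 addr0.
  apply: inner_orth0 => u; have [v Av <-] := surz u.
  by rewrite innerC shift // yx innerC conjCK xA.
split=> //; suff E y : dom (adjoint A) y -> dom A y.
  have dAA : dom (adjoint A) = dom A.
    apply/seteqP; split=> // y Ay.
    by have [] := @adjoint_eq _ _ _ A y (A y) dA (fun x Ax => symA x y Ax Ay).
  split=> // y; rewrite dAA => Ay.
  by have [] := @adjoint_eq _ _ _ A y (A y) dA (fun x Ax => symA x y Ax Ay).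
move=> Ay; have [u Au uE] := surz' (adjoint A y + Num.conj z *: y).
suff -> : y = u by [].
apply: inner_ext => w; have [x Ax <-] := surz w.
rewrite [RHS]shift // uE innerDl innerDr innerZl innerZr conjCK.
by rewrite adjointP.
Qed.

Lemma sa_shift A z x y : self_adjoint A -> dom A x -> dom A y ->
  inner (- A x + z *: x) y = inner x (- A y + Num.conj z *: y).
Proof.
move=> sA Ax Ay; rewrite innerDl innerDr innerZl innerZr innerNl innerNr.
by rewrite conjCK (sa_sym sA).
Qed.

Lemma sa_shift_max A z y f : self_adjoint A ->
    (forall x, dom A x -> inner (- A x + z *: x) y = inner x f) ->
  dom A y /\ - A y + Num.conj z *: y = f.
Proof.
move=> sA yf; have [|Ay E] := @sa_max A y (Num.conj z *: y - f) sA.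
  move=> x Ax; rewrite innerBr -yf // innerDl innerNl innerZl innerZr conjCK.
  by rewrite opprD opprK addrCA subrr addr0.
by split=> //; rewrite E opprB subrK.
Qed.

(** The lower bound gives injectivity and the bound on the inverse; the trivial kernel at [conj z]
    makes the range dense; approximate solutions then converge to an exact one. *)
Lemma sa_resolvent_set A z (M : C) : self_adjoint A -> 0 <= M ->
    (forall x, dom A x -> `|x| <= M * `|- A x + z *: x|) ->
    (forall x, dom A x -> - A x + Num.conj z *: x = 0 -> x = 0) ->
  resolvent_set A z.
Proof.
move=> sA M0 below inj'; have [lA dA _] := sA.
have lz := op_shift_linear lA z.
apply: resolvent_setI => //.
  move=> x Ax E; apply/eqP; rewrite -normr_eq0 eq_le normr_ge0 andbT.
  by rewrite (le_trans (below x Ax)) // E normr0 mulr0.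
exists M => f.
suff [x [Ax xf]] : exists x, dom A x /\ - A x + z *: x = f.
  by exists x; split=> //; rewrite -xf below.
have dran : dense [set - A x + z *: x | x in dom A].
  apply: dense_orth0; last first.
    move=> y yr; have [|Ay y0] := @sa_shift_max A z y 0 sA.
      move=> x Ax; rewrite inner0r innerC yr ?rmorph0 //.
      by exists x.
    exact: inj' Ay y0.
  split=> [|a _ _ [x Ax <-] [y Ay <-]].
    by exists 0; [exact: lin_dom0 lA | rewrite (lin_0 lA) oppr0 scaler0 addr0].
  exists (a *: x + y); first exact: (lin_domP lA).
  exact: (lin_P lz).
pose S e := [set x | dom A x /\ `|f - (- A x + z *: x)| < e].
have [||e e0|l lS] := @nested_cluster _ _ S.
- by move=> e e0; have /denseP/(_ f e e0)[_ [x Ax <-] xe] := dran; exists x.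
- by move=> e e' e0 ee' x [Ax xe]; split=> //; exact: lt_le_trans ee'.
- have M1 : 0 < M + 1 by rewrite ltr_wpDl.
  (* Two residuals of this size put the solutions at distance less than [e]; [M + 1] replaces [M] to
     keep the denominator positive. *)
  exists (e / (2 * (M + 1))); first by rewrite divr_gt0 // mulr_gt0.
  move=> x y [Ax xe] [Ay ye].
  have := below _ (lin_domB lA Ax Ay).
  rewrite -[- A _ + _]/(op_shift A z (x - y)) (lin_B lz) //= => /le_lt_trans;
    apply.
  rewrite (@le_lt_trans _ _ ((M + 1) * `|- A x + z *: x - (- A y + z *: y)|)) //.
    by rewrite ler_wpM2r // lerDl ler01.
  have -> : e = (M + 1) * (e / (2 * (M + 1)) + e / (2 * (M + 1))).
    by field; rewrite ?gt_eqF.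
  rewrite ltr_pM2l // -(subrKA f) (le_lt_trans (ler_normD _ _)) // ltrD //.
  by rewrite distrC.
(* The limit [l] is shown to be a solution weakly, against all [x] in the domain; maximality of a
   self-adjoint operator then puts [l] in the domain. *)
exists l; rewrite -[z]conjCK; apply: sa_shift_max => // x Ax.
apply/subr0_eq; set w := - A x + _.
apply: (@approx_eq0 _ _ (`|w| + `|x|)); first by rewrite addr_ge0.
move=> e e0; have [u [Au ue] lu] := lS e e e0 e0.
have -> : inner w l - inner x f =
    inner w (l - u) - inner x (f - (- A u + z *: u)).
  rewrite !innerBr (_ : inner x (- A u + _) = inner w u); last first.
    by rewrite /w (sa_shift _ sA) // conjCK.
  by rewrite opprB addrA subrK.
rewrite (le_trans (ler_normB _ _)) // mulrDr.
rewrite lerD // (le_trans (CauchySchwarz_inner _ _)) // mulrC;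
  by rewrite ler_wpM2r // ltW.
Qed.

End SelfAdjoint.

(** * The resolvents at [i] and [- i], and the Cayley transform *)

Section Cayley.
Variables (R : realType) (H : hilbertType R) (A : operator H H).
Local Notation C := R[i].
Local Notation i := ('i%C : C).
Hypothesis sA : self_adjoint A.
Implicit Types (x y f g : H) (a z : C).

Let lA : linear_op A. Proof. by case: sA. Qed.

Lemma conj_i : Num.conj i = - i.
Proof. by apply/eqP; rewrite eq_complex /= oppr0 !eqxx. Qed.

Lemma mulii : i * i = -1.
Proof.
by apply/eqP; rewrite eq_complex /= !(mulr0, mul0r, mulr1, subr0, addr0, sub0r) oppr0 !eqxx.
Qed.

(** The conditions on [e] cover [i] and [- i] at once; the cross terms cancel because [A] is
    symmetric. *)
Lemma sa_shift_norm e x : Num.conj e = - e -> e * e = -1 -> dom A x ->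
  `|- A x + e *: x| ^+ 2 = inner_plus A x x.
Proof.
move=> ce ee Ax; rewrite inner_normE /inner_plus.
rewrite !(innerDl, innerDr, innerNl, innerNr, innerZl, innerZr).
rewrite ce (sa_sym sA Ax Ax).
set u := inner (A x) (A x); set v := inner x x; set w := inner x _.
rewrite -[v in RHS]mul1r -[1]opprK -ee; ring.
Qed.

Lemma sa_resolvent_imag e : Num.conj e = - e -> e * e = -1 -> resolvent_set A e.
Proof.
move=> ce ee.
have below e' x : Num.conj e' = - e' -> e' * e' = -1 -> dom A x ->
    `|x| <= `|- A x + e' *: x|.
  move=> ce' ee' Ax; rewrite -(@ler_pXn2r _ 2) ?nnegrE // sa_shift_norm //.
  by rewrite inner_normE /inner_plus lerDr inner_ge0.
apply: (sa_resolvent_set (M := 1)) => // x Ax; first by rewrite mul1r below.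
move=> E; apply/eqP; rewrite -normr_eq0 eq_le normr_ge0 andbT.
rewrite (le_trans (below (Num.conj e) x _ _ Ax)) ?E ?normr0 //.
  by rewrite conjCK ce opprK.
by rewrite ce mulrNN.
Qed.

Lemma resolvent_i : resolvent_set A i.
Proof. by apply: sa_resolvent_imag; [exact: conj_i | exact: mulii]. Qed.

Lemma resolvent_Ni : resolvent_set A (- i).
Proof.
by apply: sa_resolvent_imag; [rewrite rmorphN /= conj_i | rewrite mulrNN mulii].
Qed.

Lemma resolvent_conj_adj z f g : resolvent_set A z ->
  resolvent_set A (Num.conj z) ->
  inner (resolvent A z f) g = inner f (resolvent A (Num.conj z) g).
Proof.
move=> rz rz'; have [rA rE] := resolventP f rz;
  have [rA' rE'] := resolventP g rz'.
by rewrite -[in LHS]rE' -[in RHS]rE (sa_shift _ sA).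
Qed.

(** By symmetry [|x|^2] is the inner product of [resolvent A z x] with [- A x + conj z x], so the
    bound for the resolvent at [z] is a lower bound for the shift at [conj z]. *)
Lemma resolvent_set_conj z : resolvent_set A z -> resolvent_set A (Num.conj z).
Proof.
move=> rz; have [M M0 rM] := bounded_op_norm rz.2.
apply: (sa_resolvent_set (M := M)) => // x Ax; last first.
  rewrite conjCK => E; rewrite -(resolventK rz Ax) E.
  by have [_ [_ lr _]] := rz; exact: lin_0 lr.
have [->|x0] := eqVneq x 0; first by rewrite normr0 mulr_ge0.
have [rA rE] := resolventP x rz.
have := CauchySchwarz_inner (resolvent A z x) (- A x + Num.conj z *: x).
rewrite -(sa_shift _ sA) // rE -inner_normE normrX normr_id => /le_trans.
move=> /(_ _ (ler_wpM2r (normr_ge0 _) (rM x))).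
by rewrite expr2 mulrAC ler_pM2r ?normr_gt0.
Qed.

(** This is [(-A - i) (-A + i)^-1], and [cayley_inv] is [(-A + i) (-A - i)^-1], both written so as
    to be defined on all vectors. *)
Definition cayley f := f - (2 * i) *: resolvent A i f.

Definition cayley_inv f := f + (2 * i) *: resolvent A (- i) f.

Lemma resolvent_cayley f : resolvent A (- i) (cayley f) = resolvent A i f.
Proof.
have [rA rE] := resolventP f resolvent_i.
rewrite -[RHS](resolventK resolvent_Ni rA) /cayley; congr (resolvent A _ _).
rewrite -[in LHS]rE (resolventK resolvent_i) //; hilbert_ring.
Qed.

Lemma resolvent_cayley_inv f : resolvent A i (cayley_inv f)
  = resolvent A (- i) f.
Proof.
have [rA rE] := resolventP f resolvent_Ni.
rewrite -[RHS](resolventK resolvent_i rA) /cayley_inv; congr (resolvent A _ _).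
rewrite -[in LHS]rE (resolventK resolvent_Ni) //; hilbert_ring.
Qed.

Lemma cayleyK : cancel cayley cayley_inv.
Proof. by move=> f; rewrite /cayley_inv resolvent_cayley subrK. Qed.

Lemma cayley_invK : cancel cayley_inv cayley.
Proof. by move=> f; rewrite /cayley resolvent_cayley_inv addrK. Qed.

Lemma cayley_adj f g : inner (cayley f) g = inner f (cayley_inv g).
Proof.
have := @resolvent_conj_adj i f g resolvent_i.
rewrite conj_i => /(_ resolvent_Ni).
rewrite /cayley /cayley_inv innerBl innerDr innerZl innerZr => ->.
by rewrite rmorphM /= conjC_nat conj_i mulrN mulNr.
Qed.

Lemma cayley_linear a f g : cayley (a *: f + g) = a *: cayley f + cayley g.
Proof.
by rewrite /cayley resolvent_linear; [hilbert_ring | exact: resolvent_i].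
Qed.

Lemma cayley_inv_linear a f g :
  cayley_inv (a *: f + g) = a *: cayley_inv f + cayley_inv g.
Proof.
by rewrite /cayley_inv resolvent_linear; [hilbert_ring | exact: resolvent_Ni].
Qed.

Lemma cayley_isometry f g : inner (cayley f) (cayley g) = inner f g.
Proof. by rewrite cayley_adj cayleyK. Qed.

End Cayley.

(** * Krein's resolvent formula *)

Section Krein.
Variables (R : realType) (H : hilbertType R) (A B : operator H H).
Local Notation C := R[i].
Local Notation i := ('i%C : C).
Hypotheses (sA : self_adjoint A) (sB : self_adjoint B).
Implicit Types (f g phi : H) (a z : C).

Let rA := resolvent_i sA.
Let rB := resolvent_i sB.

Definition coincidence : set H := [set f | resolvent A i f = resolvent B i f].
Local Notation L := coincidence.
Local Notation h := (orthc coincidence).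
Local Notation P := (@orth_proj R H coincidence).

Lemma coincidenceP f : L f <-> resolvent A i f = resolvent B i f.
Proof. by []. Qed.

Lemma coincidence_subspace : linear_subspace L.
Proof.
split=> [|a f g fL gL]; apply/coincidenceP; first by rewrite !resolvent0.
by rewrite !resolvent_linear // fL gL.
Qed.

Lemma coincidence_closed : closed L.
Proof.
move=> f fL; apply/subr0_eq/eqP; rewrite -normr_eq0; apply/eqP.
have [M M0 rM] := bounded_op_norm rA.2; have [N N0 sN] := bounded_op_norm rB.2.
apply: (@approx_eq0 _ _ (M + N)); first by rewrite addr_ge0.
move=> e e0; have [g [gL]] := fL _ (nbhsx_ballx f e e0).
rewrite normr_id -ball_normE => fg.
have -> : resolvent A i f - resolvent B i f =
    resolvent A i (f - g) - resolvent B i (f - g).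
  by rewrite !resolventB // gL opprB addrA subrK.
rewrite (le_trans (ler_normB _ _)) // mulrDr mulrC (mulrC e).
by rewrite lerD // (le_trans (rM _), le_trans (sN _)) // ler_wpM2l // ltW.
Qed.

Let sL := coincidence_subspace.
Let cL := coincidence_closed.

(* The operator Lam P of the header, first as a map from H to H. *)
Definition rel_defect f := cayley_inv A (resolvent B i f - resolvent A i f).

(** For [l] in [L] the two Cayley transforms agree. Moving the resolvents onto
    [cayley A l = cayley B l] turns them into resolvents at [- i], which by [resolvent_cayley] give
    [resolvent B i l - resolvent A i l = 0]. *)
Lemma rel_defect_orth f : orth_pred L (rel_defect f).
Proof.
apply/orth_predP => l Ll; rewrite /rel_defect innerC.
have <- : inner (cayley A l) (resolvent B i f - resolvent A i f) =
   inner l (rel_defect f) by exact: cayley_adj.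
have -> : inner (cayley A l) (resolvent B i f - resolvent A i f) = 0.
  have rNA := resolvent_Ni sA; have rNB := resolvent_Ni sB.
  have cAB : cayley A l = cayley B l by rewrite /cayley Ll.
  have adj T w : self_adjoint T -> inner w (resolvent T i f)
    = inner (resolvent T (- i) w) f.
    move=> sT; have := @resolvent_conj_adj _ _ _ sT i f w (resolvent_i sT).
    rewrite conj_i => /(_ (resolvent_Ni sT)) E.
    by rewrite innerC E -innerC.
  by rewrite innerBr !adj // {1}cAB !resolvent_cayley // Ll subrr.
by rewrite rmorph0.
Qed.

Definition defect f : h := exist _ (rel_defect f) (rel_defect_orth f).

Lemma defectE f : val (defect f) = rel_defect f.
Proof. by []. Qed.

Lemma cayley_defect f :
  cayley A (val (defect f)) = resolvent B i f - resolvent A i f.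
Proof. exact: cayley_invK. Qed.

Lemma defect_linear a f g : defect (a *: f + g) = a *: defect f + defect g.
Proof.
apply: val_inj; rewrite linearP !defectE /rel_defect !resolvent_linear //.
rewrite -cayley_inv_linear //; congr (cayley_inv _ _); hilbert_ring.
Qed.

Lemma defectB f g : defect (f - g) = defect f - defect g.
Proof. by rewrite addrC -scaleN1r defect_linear scaleN1r addrC. Qed.

Lemma defect_eq0 f : defect f = 0 <-> L f.
Proof.
split=> [f0|fL].
  by apply/esym/subr0_eq;
    rewrite -cayley_defect f0 raddf0 /cayley resolvent0 // scaler0 subrr.
apply: val_inj; rewrite raddf0 defectE /rel_defect fL subrr /cayley_inv.
by rewrite resolvent0 ?scaler0 ?addr0 //; exact: resolvent_Ni.
Qed.

(** In the notation [defect = Lam P], one direction says that [Lam] is well defined on [h], the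
    other that it is injective. *)
Lemma defect_eq f g : defect f = defect g <-> P f = P g.
Proof.
have -> : defect f = defect g <-> L (f - g).
  rewrite -defect_eq0 defectB; split=> [->|/subr0_eq //]; exact: subrr.
split=> [/orth_proj0 E|fg].
  by apply/subr0_eq; rewrite -orth_projB // E.
rewrite -[f - g](subr0) -[0](raddf0 (val : h -> H)) -(subrr (P f)).
by rewrite {2}fg -orth_projB //; exact: orth_projP.
Qed.

(* Lam^-1 - i: by [defect_eq], [P f] does not depend on the choice of [f]. *)
Definition Krein_theta : operator h h :=
  Operator (range defect)
    (fun zeta => P (xget 0 [set f | defect f = zeta]) - i *: zeta).
Local Notation Theta := Krein_theta.

Lemma Krein_thetaE f : Theta (defect f) = P f - i *: defect f.
Proof.
congr (_ - _); apply/defect_eq.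
by apply: (@xgetPex _ 0 [set g | defect g = defect f]); exists f.
Qed.

Lemma Krein_theta_self_adjoint : self_adjoint Theta.
Proof.
apply: (self_adjointI (z := i)).
- split=> [|a _ _ [f _ <-] [g _ <-]|a _ _ [f _ <-] [g _ <-]].
  + by exists 0 => //; apply/defect_eq0; case: sL.
  + by exists (a *: f + g) => //; exact: defect_linear.
  + by rewrite -defect_linear !Krein_thetaE defect_linear orth_proj_linear //;
      hilbert_ring.
- move=> _ _ [f _ <-] [g _ <-]; rewrite !Krein_thetaE.
  rewrite innerBl innerBr innerZl innerZr conj_i orth_proj_inner //
    [inner _ (P g)]innerC.
  rewrite orth_proj_inner // -innerC !orthc_innerE.
  (* All inner products are moved under [cayley A], where [cayley B] is [cayley A] composed with
     [1 - 2 i defect]. Expanding the isometry identity of [cayley B] gives [2 i] times the symmetry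
     of [Theta]. *)
  rewrite -(cayley_isometry sA) -(cayley_isometry sA (val (defect f)) g).
  rewrite -(cayley_isometry sA (val (defect f)) (val (defect g))).
  have cB k : cayley B k = cayley A k - (2 * i) *: cayley A (val (defect k)).
    by rewrite cayley_defect /cayley; hilbert_ring.
  have := cayley_isometry sB f g; rewrite -(cayley_isometry sA f g) !cB.
  move: (cayley A f) (cayley A g) (cayley A (val (defect f)))
    (cayley A (val (defect g))) => u v w t.
  rewrite !(innerBl, innerBr, innerZl, innerZr) rmorphM /= conjC_nat conj_i.
  move=> E; have i20 : 2 * i != 0.
    by rewrite mulf_neq0 ?pnatr_eq0 // eq_complex /= oner_eq0 andbF.
  by apply: (mulfI i20); apply/subr0_eq; rewrite -(subrr (inner u v)) -{1}E;
    ring.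
(* [Theta + i] sends [defect f] to [P f]. *)
- move=> z; exists (defect (val z)); first by exists (val z).
  by rewrite Krein_thetaE subrK orth_projK.
(* [Theta - i] sends [defect f] to [P (f - 2 i defect f)], where [f - 2 i defect f] equals
   [cayley_inv A (cayley B f)]; the choice of [f] makes this vector [val z]. *)
- move=> z; pose f := cayley_inv B (cayley A (val z)).
  exists (defect f); first by exists f.
  have <- : P (val z) = z by rewrite orth_projK.
  have -> : val z = f - (2 * i) *: val (defect f).
    rewrite -[LHS](cayleyK sA) -[cayley A _](cayley_invK sB) -/f.
    have -> : cayley B f = cayley A (f - (2 * i) *: val (defect f)).
      rewrite addrC -scaleNr cayley_linear // cayley_defect /cayley;
        hilbert_ring.
    by rewrite cayleyK.
  rewrite Krein_thetaE conj_i [RHS]orth_projB // -[_ *: val _]addr0 orth_proj_linear //.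
  have -> : P 0 = 0 by apply: orth_proj0 => //; case: sL.
  rewrite orth_projK // addr0.
  hilbert_ring.
Qed.

End Krein.

(** * The map [tau], the operators [G(z)] and [G_*], and the description of [B] *)

Section KreinFormula.
Variables (R : realType) (H : hilbertType R) (A B : operator H H).
Local Notation C := R[i].
Local Notation i := ('i%C : C).
Hypotheses (sA : self_adjoint A) (sB : self_adjoint B).
Implicit Types (f g phi : H) (a z : C).

Let lA : linear_op A. Proof. by case: sA. Qed.
Let lB : linear_op B. Proof. by case: sB. Qed.
Let rA := resolvent_i sA.
Let rB := resolvent_i sB.

Local Notation L := (coincidence A B).
Local Notation h := (orthc L).
Local Notation P := (@orth_proj R H L).
Local Notation Theta := (Krein_theta sA sB).
Local Notation defect := (defect sA sB).

Let sL : linear_subspace L := coincidence_subspace sA sB.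
Let cL : closed L := coincidence_closed sA sB.

Definition Krein_tau : operator H h := Operator (dom A)
  (fun x => P (- A x + i *: x)).
Local Notation tau := Krein_tau.

Lemma Krein_tauE f : tau f = P (- A f + i *: f).
Proof. by []. Qed.

Lemma Krein_tau_linear : linear_op tau.
Proof.
split=> [|a x y Ax Ay|a x y Ax Ay].
- exact: lin_dom0 lA.
- exact: (lin_domP lA).
- rewrite !Krein_tauE -orth_proj_linear //; congr (orth_proj _).
  rewrite (lin_P lA) //; hilbert_ring.
Qed.
Let ltau := Krein_tau_linear.

Lemma Krein_tau_resolvent f : tau (resolvent A i f) = P f.
Proof. by have [_ E] := resolventP f rA; rewrite Krein_tauE E. Qed.

(** By [sa_shift_norm], [-A + i] is isometric from the graph norm to the norm of [H], and the
    projection is a contraction; hence the constant [1]. *)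
Lemma Krein_tau_bounded : bounded_op_plus A tau.
Proof.
split=> //; exists 1 => x Ax;
  rewrite mul1r (le_trans (orth_proj_norm sL cL _)) //.
rewrite /norm_plus -(sa_shift_norm sA (conj_i _) (mulii _)) //.
by rewrite exprCK.
Qed.

Lemma Krein_tau_surjective : op_ran tau = setT.
Proof.
apply/seteqP; split=> // xi _; exists (resolvent A i (val xi)).
  by have [] := resolventP (val xi) rA.
by rewrite Krein_tau_resolvent orth_projK.
Qed.

(** Where [A] and [B] agree, so do [-A + i] and [-B + i], whose common value then lies in [L] and is
    killed by [P]. *)
Lemma Krein_tau_ker_dense :
  dense [set x | [/\ dom B x, dom A x & B x = A x]] -> closure (op_ker tau)
    = setT.
Proof.
move=> /denseP dD; apply/seteqP; split=> // x _ U /nbhs_ballP[e e0 eU].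
have [y [By Ay E] xy] := dD x e e0.
exists y; split; last by apply: eU; rewrite -ball_normE.
split=> //; rewrite Krein_tauE orth_proj0 //; apply/coincidenceP.
by rewrite resolventK // -E resolventK.
Qed.

(** The operator [(-A - i) (-A + z)^-1] restricted to [h]: the adjoint of
    [P (-A + i) (-A + conj z)^-1]. *)
Definition Krein_G z (zeta : h) : H :=
  val zeta - (i + z) *: resolvent A z (val zeta).
Local Notation G := Krein_G.

Lemma Gop_total z : resolvent_set A z ->
  dom (Gop A tau z) = setT /\ forall zeta, Gop A tau z zeta = G z zeta.
Proof.
move=> rz; have rz' := resolvent_set_conj sA rz.
pose S := op_comp tau (resolvent A (Num.conj z)).
have dS : dom S = setT.
  apply/seteqP; split=> // f _; split; first by case: rz' => _ [->].
  by have [] := resolventP f rz'.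
have SG zeta : dom (adjoint S) zeta /\ adjoint S zeta = G z zeta.
  apply: adjoint_eq; first by move=> U [x Ux] _; rewrite dS setIT; exists x.
  move=> f _; have [rAf rE] := resolventP f rz'.
  have -> : inner (S f) zeta = inner (tau (resolvent A (Num.conj z) f)) zeta
    by [].
  rewrite Krein_tauE orth_proj_inner // /G innerBr innerZr.
  have := @resolvent_conj_adj _ _ _ sA (Num.conj z) f (val zeta) rz'.
  rewrite conjCK => /(_ rz) <-; rewrite rmorphD /= conj_i -{3}rE.
  by rewrite !(innerDl, innerNl, innerZl); ring.
split; last by move=> zeta; have [] := SG zeta.
by apply/seteqP; split=> // zeta _; have [] := SG zeta.
Qed.

(** [G(conj z)] is itself the adjoint of [tau R(z)], so a second adjoint gives [tau R(z)] back; this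
    evaluates the last factor of the resolvent formula. *)
Lemma adjoint_Gop z f : resolvent_set A z ->
  dom (adjoint (Gop A tau (Num.conj z))) f /\
  adjoint (Gop A tau (Num.conj z)) f = tau (resolvent A z f).
Proof.
move=> rz; have rz' := resolvent_set_conj sA rz.
have [dG GE] := Gop_total rz'.
apply: adjoint_eq; first by move=> U [x Ux] _; rewrite dG setIT; exists x.
move=> zeta _; rewrite GE Krein_tauE [RHS]innerC orth_proj_inner // -innerC.
have [rAf rE] := resolventP f rz.
have := @resolvent_conj_adj _ _ _ sA (Num.conj z) (val zeta) f rz'.
rewrite conjCK => /(_ rz) E; rewrite /G innerBl innerZl E -{1}rE.
rewrite !(innerDr, innerNr, innerZr) conj_i; ring.
Qed.

(** The mean of [G(i) = 1 - 2 i R(i)] and of the inclusion [G(-i)]. *)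
Lemma Gstar_total :
  dom (Gstar A tau) = setT /\
  forall zeta, Gstar A tau zeta = val zeta - i *: resolvent A i (val zeta).
Proof.
have [d1 E1] := Gop_total rA; have [d2 E2] := Gop_total (resolvent_Ni sA).
split.
  have -> : dom (Gstar A tau) = dom (Gop A tau i) `&` dom (Gop A tau (- i))
    by [].
  by rewrite d1 d2 setIT.
move=> zeta.
have -> : Gstar A tau zeta = 2^-1 *: (Gop A tau i zeta + Gop A tau (- i) zeta)
  by [].
rewrite E1 E2 /G subrr scale0r subr0.
apply: inner_extl => u; rewrite !(innerDl, innerNl, innerZl).
by field.
Qed.

(** [cayley_defect] with [cayley A = 1 - 2 i R(i)]: half of the resolvent term goes to the component
    in [dom A], the other half to [G_*]. *)
Lemma resolvent_domain_split f :
  resolvent B i f =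
  resolvent A i (f - i *: val (defect f)) + Gstar A tau (defect f).
Proof.
rewrite Gstar_total.2 resolventB // resolventZ //.
have := cayley_defect sA sB f; rewrite /cayley => /eqP.
rewrite eq_sym subr_eq => /eqP ->; hilbert_ring.
Qed.

Lemma Krein_theta_tau f :
  Theta (defect f) = tau (resolvent A i (f - i *: val (defect f))).
Proof.
rewrite Krein_tau_resolvent Krein_thetaE addrC -scaleNr.
by rewrite [f - _]addrC -scaleNr orth_proj_linear // orth_projK.
Qed.

(** Converse of the splitting. The vector [f] is forced by [phis = R(i) (f - i zeta)], and the
    boundary condition says [P f = (Theta + i) zeta], that is [defect f = zeta]. *)
Lemma domain_merge phis zeta : dom A phis -> dom Theta zeta ->
    Theta zeta = tau phis ->
  let f := - A phis + i *: phis + i *: val zeta in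
  defect f = zeta /\ resolvent B i f = phis + Gstar A tau zeta.
Proof.
move=> Aphis [g _ <-] E f.
have fg : defect f = defect g.
  apply/defect_eq; rewrite /f addrC orth_proj_linear // orth_projK //.
  by rewrite -Krein_tauE -E Krein_thetaE addrC subrK.
split=> //; rewrite resolvent_domain_split fg; congr (_ + _).
by rewrite /f addrK resolventK.
Qed.

Lemma dom_perturbation :
  dom B = [set phi | exists phis zeta,
    [/\ phi = phis + Gstar A tau zeta, dom A phis, dom Theta zeta &
        Theta zeta = tau phis]].
Proof.
apply/seteqP; split=> [phi Bphi|_ [phis [zeta [-> Aphis Tzeta E]]]].
  rewrite -(resolventK rB Bphi); set f := (X in resolvent B _ X).
  exists (resolvent A i (f - i *: val (defect f))), (defect f).
  split; first exact: resolvent_domain_split.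
  - by have [] := resolventP (f - i *: val (defect f)) rA.
  - by exists f.
  - exact: Krein_theta_tau.
have [_ <-] := domain_merge Aphis Tzeta E.
by have [] := resolventP (- A phis + i *: phis + i *: val zeta) rB.
Qed.

(** For [ring] the unit [i] is an indeterminate, so [i * i = -1] is supplied as a multiple of this
    vanishing expression. *)
Let ii0 : i * i + 1 = 0. Proof. by rewrite mulii addNr. Qed.

Lemma perturbationE phis zeta : dom A phis -> dom Theta zeta ->
    Theta zeta = tau phis ->
  B (phis + Gstar A tau zeta) = A phis + resolvent A i (val zeta).
Proof.
move=> Aphis Tzeta E; have [_ rE] := domain_merge Aphis Tzeta E.
have [] := resolventP (- A phis + i *: phis + i *: val zeta) rB.
rewrite rE => _ BE; set phi := phis + _ in BE *.
have -> : B phi = i *: phi - (- B phi + i *: phi).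
  by rewrite opprD opprK addrCA subrr addr0.
rewrite BE /phi Gstar_total.2; set r := resolvent _ _ _.
apply: inner_extl => u; rewrite !(innerDl, innerNl, innerZl).
apply/subr0_eq; rewrite -[RHS](mul0r (- inner r u)) -ii0; ring.
Qed.

(** * Decomposition at a general point [z] and the resolvent formula *)

Section Shifted.
Variable z : C.
Hypothesis rz : resolvent_set A z.
Local Notation Tz := (Theta_shift A tau Theta z).

(** The term [val zeta] cancels and only resolvents of [A] remain. The form [+ -1 *:] is what
    [op_sub] unfolds to. *)
Lemma Gstar_sub_dom zeta : dom A (Gstar A tau zeta + -1 *: Gop A tau z zeta).
Proof.
rewrite Gstar_total.2 (Gop_total rz).2 /G.
have -> : val zeta - i *: resolvent A i (val zeta) +
    -1 *: (val zeta - (i + z) *: resolvent A z (val zeta)) =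
    (i + z) *: resolvent A z (val zeta) - i *: resolvent A i (val zeta).
  by hilbert_ring.
by apply: (lin_domB lA); apply: (lin_domZ lA); [case: (resolventP (val zeta) rz)
  | case: (resolventP (val zeta) rA)].
Qed.

Lemma dom_Theta_shift : dom Tz = dom Theta.
Proof.
apply/seteqP; split=> zeta; first by case.
move=> Tzeta; split=> //; split; last exact: Gstar_sub_dom.
by split; [rewrite Gstar_total.1 |
  rewrite -[dom _]/(dom (Gop A tau z)) (Gop_total rz).1].
Qed.

Lemma Theta_shiftE zeta :
  Tz zeta = Theta zeta + tau (Gstar A tau zeta + -1 *: Gop A tau z zeta).
Proof. by []. Qed.

Lemma Theta_shift_linear : linear_op Tz.
Proof.
have [lT _ _] := Krein_theta_self_adjoint sA sB.
split; rewrite ?dom_Theta_shift.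
- exact: lin_dom0 lT.
- by move=> a x y Tx Ty; apply: (lin_domP lT).
- move=> a x y Tx Ty; rewrite !Theta_shiftE (lin_P lT) //.
  rewrite [in RHS]scalerDr [RHS]addrACA -(lin_P ltau);
    [|exact: Gstar_sub_dom..].
  congr (_ + tau _); rewrite !Gstar_total.2 !(Gop_total rz).2 /G !linearP.
  rewrite !resolvent_linear //; hilbert_ring.
Qed.

Lemma Gop_split phis zeta :
  phis + Gstar A tau zeta =
  (phis + (Gstar A tau zeta + -1 *: Gop A tau z zeta)) + G z zeta.
Proof. by rewrite (Gop_total rz).2 -addrA scaleN1r subrK. Qed.

(** The vector [(G_* - G(z)) zeta] is moved into the component in [dom A], and its image under [tau]
    is added to both sides of the boundary condition. *)
Lemma dom_perturbation_shift phi :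
  dom B phi <-> exists psi zeta,
    [/\ phi = psi + G z zeta, dom A psi, dom Theta zeta & Tz zeta = tau psi].
Proof.
rewrite dom_perturbation; split=> [[phis [zeta [-> Aphis Tzeta E]]]|].
  exists (phis + (Gstar A tau zeta + -1 *: Gop A tau z zeta)), zeta.
  have D := Gstar_sub_dom zeta.
  split=> //; first by rewrite -Gop_split.
    exact: (lin_domD lA).
  by rewrite Theta_shiftE E [RHS](lin_D ltau).
move=> [psi [zeta [-> Apsi Tzeta E]]].
have D := Gstar_sub_dom zeta.
exists (psi - (Gstar A tau zeta + -1 *: Gop A tau z zeta)), zeta.
split=> //; first by rewrite Gop_split subrK.
  exact: (lin_domB lA).
by rewrite (lin_B ltau) // -E Theta_shiftE addrK.
Qed.

(** The part [G z zeta] contributes nothing, being orthogonal to the image of the kernel of [tau]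
    under [-A + conj z]. The proof is a direct computation from [perturbationE]. *)
Lemma perturbation_shiftE psi zeta :
    dom A psi -> dom Theta zeta -> Tz zeta = tau psi ->
  - B (psi + G z zeta) + z *: (psi + G z zeta) = - A psi + z *: psi.
Proof.
move=> Apsi Tzeta E; have D := Gstar_sub_dom zeta.
set phis := psi - (Gstar A tau zeta + -1 *: Gop A tau z zeta).
have Aphis : dom A phis by exact: (lin_domB lA).
have phisE : psi + G z zeta = phis + Gstar A tau zeta.
  by rewrite Gop_split subrK.
have Ephis : Theta zeta = tau phis.
  by rewrite (lin_B ltau) // -E Theta_shiftE addrK.
rewrite {1}phisE perturbationE // (lin_B lA) //.
rewrite Gstar_total.2 (Gop_total rz).2 /G.
have [Ar rE] := resolventP (val zeta) rA;
  have [Ar' rE'] := resolventP (val zeta) rz.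
move: Ar rE Ar' rE'; set r := resolvent A i _; set s := resolvent A z _.
move=> Ar rE Ar' rE'.
have -> : val zeta - i *: r + -1 *: (val zeta - (i + z) *: s)
  = (i + z) *: s - i *: r.
  by hilbert_ring.
rewrite (lin_B lA) ?(lin_Z lA) //; [|exact: (lin_domZ lA)..].
have -> : A r = i *: r - val zeta by rewrite -rE opprD opprK addrCA subrr addr0.
have -> : A s = z *: s - val zeta
  by rewrite -rE' opprD opprK addrCA subrr addr0.
apply: inner_extl => u; rewrite !(innerDl, innerNl, innerZl).
apply/subr0_eq; rewrite -[RHS](mul0r (- inner r u)) -ii0; ring.
Qed.

Let lTz := Theta_shift_linear.

(** As [G(z)] is [(-A - i) R(z)], applying [R(-i)] to [G(z) zeta] returns [R(z) zeta]. This gives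
    injectivity of [G(z)] and bounds [zeta] by [G(z) zeta]. *)
Lemma Krein_GK zeta :
  val zeta = G z zeta + (i + z) *: resolvent A (- i) (G z zeta).
Proof.
have [As sE] := resolventP (val zeta) rz.
have <- : resolvent A z (val zeta) = resolvent A (- i) (G z zeta).
  rewrite /G; move: (resolvent A z (val zeta)) As sE => s As <-.
  rewrite -[LHS](resolventK (resolvent_Ni sA) As); congr (resolvent _ _ _).
  hilbert_ring.
by rewrite subrK.
Qed.

Lemma Krein_G0 : G z 0 = 0.
Proof. by rewrite /G raddf0 resolvent0 // scaler0 subrr. Qed.

Lemma Krein_G_inj zeta : G z zeta = 0 -> zeta = 0.
Proof.
move=> E; apply: val_inj;
  rewrite raddf0 Krein_GK E resolvent0 ?scaler0 ?addr0 //.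
exact: resolvent_Ni.
Qed.

Lemma Theta_shift_resolvent_set : resolvent_set B z -> resolvent_set Tz 0.
Proof.
move=> rBz; apply: (resolvent_setI lTz) => [zeta|].
  rewrite dom_Theta_shift // scale0r addr0 => Tzeta /eqP;
    rewrite oppr_eq0 => /eqP E.
  have A0 := lin_dom0 lA.
  have T0 : Tz zeta = tau 0 by rewrite E (lin_0 ltau).
  have B0 : dom B (0 + G z zeta) by apply/dom_perturbation_shift => //;
    exists 0, zeta.
  have := perturbation_shiftE A0 Tzeta T0.
  rewrite (lin_0 lA) oppr0 scaler0 addr0 => E0.
  have := resolventK rBz B0; rewrite E0 resolvent0 // add0r => /esym.
  exact: Krein_G_inj.
have [M M0 rM] := bounded_op_norm rA.2.
have [N N0 rN] := bounded_op_norm rBz.2.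
have [K K0 rK] := bounded_op_norm (resolvent_Ni sA).2.
(* The factors come from [Krein_GK], from [G z zeta = resolvent B z f - psi], and from
   [f = - xi + (z - i) psi], with [f] and [psi] as below. *)
exists ((1 + `|i + z| * K) * (N * (1 + `|z - i| * M) + M)) => xi.
pose psi := resolvent A i (val (- xi)).
have [Apsi psiE] : dom A psi /\ - A psi + i *: psi = val (- xi)
  := resolventP _ rA.
have tpsi : tau psi = - xi by rewrite Krein_tauE psiE orth_projK.
(* Decomposing [resolvent B z f] at [z] must return this [psi] as component in [dom A], so the other
   component solves [Tz zeta = tau psi = - xi]. *)
pose f := - A psi + z *: psi.
have [Bphi phiE] := resolventP f rBz.
have [psi' [zeta [E Apsi' Tzeta Ezeta]]] := (dom_perturbation_shift _).1 Bphi.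
have psi'E : psi' = psi.
  rewrite -(resolventK rz Apsi) -/f -phiE E perturbation_shiftE //.
  by rewrite resolventK.
subst psi'; exists zeta; split.
- by rewrite dom_Theta_shift.
- by rewrite scale0r addr0 Ezeta tpsi opprK.
have xiN : `|val (- xi)| = `|xi| by rewrite -orthc_normE normrN.
have fM : `|f| <= (1 + `|z - i| * M) * `|xi|.
  have -> : f = val (- xi) + (z - i) *: psi by rewrite -psiE /f; hilbert_ring.
  by rewrite -xiN; apply: normDZ_le; exact: rM.
rewrite orthc_normE Krein_GK (le_trans (normDZ_le _ (rK _))) // -mulrA.
rewrite ler_wpM2l ?addr_ge0 ?mulr_ge0 //.
have -> : G z zeta = resolvent B z f - psi by rewrite E addrAC subrr add0r.
rewrite (le_trans (ler_normB _ _)) // mulrDl lerD //; last by rewrite -xiN;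
  exact: rM.
by rewrite (le_trans (rN _)) // -mulrA ler_wpM2l.
Qed.

(** The resolvent at [0] inverts [- Tz], hence the sign of its argument. *)
Lemma Theta_shift_resolvent xi : resolvent_set Tz 0 ->
  let zeta := resolvent Tz 0 (- xi) in dom Theta zeta /\ Tz zeta = xi.
Proof.
move=> rT zeta; have [] := resolventP (- xi) rT.
by rewrite dom_Theta_shift scale0r addr0 => Tzeta /oppr_inj.
Qed.

Lemma perturbation_resolvent f zeta :
    dom Theta zeta -> Tz zeta = tau (resolvent A z f) ->
  let phi := resolvent A z f + G z zeta in
  dom B phi /\ - B phi + z *: phi = f.
Proof.
move=> Tzeta E phi; have [Ar rE] := resolventP f rz.
split; last by rewrite perturbation_shiftE.
by apply/dom_perturbation_shift => //; exists (resolvent A z f), zeta.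
Qed.

Lemma perturbation_resolvent_set : resolvent_set Tz 0 -> resolvent_set B z.
Proof.
move=> rT; apply: (resolvent_setI lB) => [phi Bphi|].
  have [psi [zeta [E Apsi Tzeta Ez]]] := (dom_perturbation_shift _).1 Bphi.
  rewrite E perturbation_shiftE // => E0.
  have psi0 : psi = 0 by rewrite -(resolventK rz Apsi) E0 resolvent0.
  rewrite psi0 add0r.
  suff -> : zeta = 0 by exact: Krein_G0.
  have Tzeta' : dom Tz zeta by rewrite dom_Theta_shift.
  rewrite -(resolventK rT Tzeta') Ez psi0 (lin_0 ltau) oppr0 scale0r addr0.
  by rewrite (resolvent0 rT).
have [M M0 rM] := bounded_op_norm rz.2.
have [K K0 rK] := bounded_op_norm rT.2.
(* The first [M] bounds [resolvent A z f]; then come the bound of [G z], the bound [K] of the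
   inverse of [- Tz], and that of [tau R(z) f = P (f + (i - z) R(z) f)]. *)
exists (M + (1 + `|- (i + z)| * M) * (K * (1 + `|i - z| * M))) => f.
pose zeta := resolvent Tz 0 (- tau (resolvent A z f)).
have [Tzeta E] := Theta_shift_resolvent (tau (resolvent A z f)) rT.
have [Bphi phiE] := perturbation_resolvent Tzeta E.
exists (resolvent A z f + G z zeta); split=> //.
rewrite (le_trans (ler_normD _ _)) // mulrDl lerD //.
rewrite /G -scaleNr (le_trans (normDZ_le _ (rM _))) // -mulrA.
rewrite ler_wpM2l ?addr_ge0 ?mulr_ge0 // -orthc_normE.
rewrite (le_trans (rK _)) // -mulrA ler_wpM2l // normrN Krein_tauE.
rewrite (le_trans (orth_proj_norm sL cL _)) //.
have [Ar rE] := resolventP f rz.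
have -> : - A (resolvent A z f) + i *: resolvent A z f
  = f + (i - z) *: resolvent A z f.
  by move: (resolvent A z f) rE => r <-; hilbert_ring.
by apply: normDZ_le; exact: rM.
Qed.

Lemma Krein_resolvent_formula : resolvent_set B z ->
  op_eq (resolvent B z)
    (op_add (resolvent A z)
       (op_comp (Gop A tau z)
          (op_comp (op_inv Tz) (adjoint (Gop A tau (Num.conj z)))))).
Proof.
move=> rBz; have rT := Theta_shift_resolvent_set rBz.
have iT : op_injective Tz.
  move=> x y Tx Ty E; apply: (rT.1 x y Tx Ty).
  by rewrite -[LHS]/(- Tz x + 0 *: x) -[RHS]/(- Tz y + 0 *: y) E !scale0r.
have key f : exists zeta, dom Theta zeta /\ Tz zeta = tau (resolvent A z f).
  by eexists; exact: Theta_shift_resolvent.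
(* By [adjoint_Gop] the argument of [op_inv Tz] is [tau (resolvent A z f)], which is [Tz zeta]. *)
have inv f zeta : dom Theta zeta -> Tz zeta = tau (resolvent A z f) ->
    dom (op_inv Tz) (adjoint (Gop A tau (Num.conj z)) f) /\
    op_inv Tz (adjoint (Gop A tau (Num.conj z)) f) = zeta.
  move=> Tzeta E; have [_ ->] := adjoint_Gop f rz; rewrite -E.
  have Tzeta' : dom Tz zeta by rewrite dom_Theta_shift.
  by split; [exists zeta | exact: op_invK].
split.
  apply/seteqP; split=> f _; last by have [_ [-> _ _]] := rBz.
  have [zeta [Tzeta E]] := key f; have [d e] := inv f zeta Tzeta E.
  split; first by have [_ [-> _ _]] := rz.
  split; last first.
    by rewrite -[dom _ _]/(dom (Gop A tau z) _) (Gop_total rz).1.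
  by split=> //; have [] := adjoint_Gop f rz.
move=> f _; have [zeta [Tzeta E]] := key f; have [d e] := inv f zeta Tzeta E.
have -> : forall X : operator H H, op_add (resolvent A z) X f
  = resolvent A z f + X f by [].
rewrite -[X in _ + X]/(Gop A tau z (op_inv Tz (adjoint (Gop A tau (Num.conj z)) f))).
rewrite e (Gop_total rz).2.
have [Bphi phiE] := perturbation_resolvent Tzeta E.
by rewrite -{1}phiE resolventK.
Qed.

End Shifted.

End KreinFormula.

Theorem corollary3p2 (R : realType) (H : hilbertType R) (A Ahat : operator H H)
    (hA : self_adjoint A) (hAhat : singular_perturbation A Ahat) :
  exists (h : hilbertType R) (tau : operator H h) (Theta : operator h h),
    [/\ bounded_op_plus A tau,
        closure (op_ker tau) = setT,
        op_ran tau = setT &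
        self_adjoint Theta] /\
    [/\ dom Ahat =
          [set phi | exists phis zeta,
             [/\ phi = phis + Gstar A tau zeta, dom A phis, dom Theta zeta &
                 Theta zeta = tau phis]],
        (forall phi phis zeta,
           phi = phis + Gstar A tau zeta -> dom A phis -> dom Theta zeta ->
           Theta zeta = tau phis ->
           Ahat phi = A phis + resolvent A 'i%C (Gop A tau (- 'i%C) zeta)),
        (forall z, resolvent_set A z ->
           ((resolvent_set Ahat `&` resolvent_set A) z <->
            resolvent_set (Theta_shift A tau Theta z) 0)) &
        (forall z, (resolvent_set Ahat `&` resolvent_set A) z ->
           op_eq (resolvent Ahat z)
             (op_add (resolvent A z)
                (op_comp (Gop A tau z)
                   (op_comp (op_inv (Theta_shift A tau Theta z))
                            (adjoint (Gop A tau (Num.conj z)))))))].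
Proof.
have [sB dAB] := hAhat.
exists (orthc (coincidence A Ahat)), (Krein_tau A Ahat), (Krein_theta hA sB).
split; split.
- exact: Krein_tau_bounded.
- exact: Krein_tau_ker_dense.
- exact: Krein_tau_surjective.
- exact: Krein_theta_self_adjoint.
- exact: dom_perturbation.
- move=> _ phis zeta -> Aphis Tzeta E; rewrite perturbationE //.
  (* At [- i] the coefficient [i + z] vanishes, so [G(-i)] is the inclusion of [h]. *)
  by rewrite (Gop_total hA sB (resolvent_Ni hA)).2 /Krein_G subrr scale0r subr0.
- move=> z rz; split=> [[rBz _]|rT]; first exact: Theta_shift_resolvent_set.
  by split=> //; exact: perturbation_resolvent_set rT.
- by move=> z [rBz rz]; exact: Krein_resolvent_formula.
Qed.
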